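(* For every natural number $n$, intuitionistic propositional logic $\mathrm{IL}$ is not base-complete over $\models^s_n$; that is, it is not the case that for all $\mathfrak{B}\in\mathbb{B}^n$, all finite sets of formulas $\Gamma$ and all formulas $A$, $\Gamma\models^s_{\mathfrak{B},n}A$ implies $\Gamma\vdash_{\mathrm{IL}\cup\mathfrak{B}}A$.
   Context: LANGUAGE. $\mathscr{L}$ is the propositional language whose formulas are built from infinitely many propositional letters and the atomic constant $\bot$ by $\wedge,\vee,\rightarrow$; $\neg X := X \rightarrow \bot$. $\mathrm{ATOM}$ is the set of the letters together with $\bot$. $\Gamma,\Delta$ always range over finite sets of formulas. ATOMIC RULES. A rule of level $0$ is an atom (an axiom). A rule of level $1$ infers an atom $A$ from atoms $A_1,\dots,A_m$. For $k\ge 1$, if $\Re_1,\dots,\Re_m$ are finite sets of atomic rules (some possibly empty) of maximal level $k-1$, then $([\Re_1]A_1,\dots,[\Re_m]A_m)/A$, which infers the atom $A$ from the atoms $A_1,\dots,A_m$ and discharges the rules in $\Re_i$ in the derivation of the $i$-th premise, is a rule of level $k+1$. ATOMIC BASES. An atomic base is a (possibly infinite) set $\mathfrak{B}$ of atomic rules containing the explosion rule $\bot/A$ for every atom $A$; its level is the maximal level of its rules other than the explosion rules ($0$ if there are none). $\mathbb{B}^n$ is the set of bases of level $\le n$. $\mathfrak{C}\supseteq_n\mathfrak{B}$ means $\mathfrak{C}\supseteq\mathfrak{B}$ and $\mathfrak{C}\in\mathbb{B}^n$. Derivations in $\mathfrak{B}$ are defined inductively: an atom $A$ is a single-node derivation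 of $A$, from no assumed rules if the axiom $A\in\mathfrak{B}$ is applied, and from the assumed rule $A$ if $A$ is assumed; if $\mathscr{D}_i$ derives $A_i$ from assumed rules $\mathfrak{C}_i\cup\Re_i$ ($i\le m$), then applying $R=([\Re_1]A_1,\dots,[\Re_m]A_m)/A$ yields a derivation of $A$ from $\bigcup_i\mathfrak{C}_i$ if $R\in\mathfrak{B}$, and from $\bigcup_i\mathfrak{C}_i\cup\{R\}$ if $R\notin\mathfrak{B}$. $\vdash_{\mathfrak{B}}A$ means that there is a derivation of $A$ in $\mathfrak{B}$ from no assumed rules. SANDQVIST'S BASE SEMANTICS. For $\mathfrak{B}\in\mathbb{B}^n$, define: for $A\in\mathrm{ATOM}$, $\models^s_{\mathfrak{B},n}A$ iff $\vdash_{\mathfrak{B}}A$; $\models^s_{\mathfrak{B},n}B\wedge C$ iff $\models^s_{\mathfrak{B},n}B$ and $\models^s_{\mathfrak{B},n}C$; $\models^s_{\mathfrak{B},n}B\vee C$ iff for all $\mathfrak{C}\supseteq_n\mathfrak{B}$ and all $D\in\mathrm{ATOM}$, if $B\models^s_{\mathfrak{C},n}D$ and $C\models^s_{\mathfrak{C},n}D$ then $\models^s_{\mathfrak{C},n}D$; $\models^s_{\mathfrak{B},n}B\rightarrow C$ iff $B\models^s_{\mathfrak{B},n}C$; for $\Gamma\ne\emptyset$, $\Gamma\models^s_{\mathfrak{B},n}A$ iff for all $\mathfrak{C}\supseteq_n\mathfrak{B}$, if $\models^s_{\mathfrak{C},n}B$ for all $B\in\Gamma$ then $\models^s_{\mathfrak{C},n}A$.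 IL OVER BASES. Extended derivations are built inductively from single formulas (assumed, or, for atoms, possibly used as axioms) by the natural deduction rules of $\mathrm{IL}$ in the standard way and by applications of arbitrary atomic rules $([\Re_1]A_1,\dots,[\Re_m]A_m)/B$, which discharge the rules $\Re_i$ used in the derivation of the $i$-th premise. $\Gamma\vdash_{\mathrm{IL}\cup\mathfrak{B}}A$ means that there is an extended derivation from $\Gamma$ to $A$ whose only additional (undischarged) atomic rules are those in $\mathfrak{B}$. *)

(* Defs.v *)
From Stdlib Require Import Ensembles List FinFun Arith.
Import ListNotations.

Set Implicit Arguments.

Section Language.

Variable L : Type.

Inductive atom : Type :=
| Letter (p : L)
| Bot.

(* The constant for absurdity is the formula [Atom Bot]. *)
Inductive formula : Type :=
| Atom (A : atom)
| And (B C : formula)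
| Or (B C : formula)
| Imp (B C : formula).

(* [Rule [(Rs1, A1); ...; (Rsm, Am)] A] is the rule ([Rs1]A1, ..., [Rsm]Am)/A;
   with no premises it is the axiom A.  The finite sets Rsi of discharged rules
   are given by lists of their elements: derivations consult these lists only
   through membership, so order and repetitions in them are immaterial. *)
Inductive rule : Type :=
| Rule (ps : list (list rule * atom)) (A : atom).

(* A premise discharging nothing contributes 1, and a premise discharging rules
   of maximal level k contributes k + 2. *)
Fixpoint level (R : rule) : nat :=
  match R with
  | Rule ps _ =>
      list_max (map (fun p => match p with
                              | ([], _) => 1
                              | (Rs, _) => 2 + list_max (map level Rs)
                              end) ps)
  end.

Definition explosion (A : atom) : rule := Rule [([], Bot)] A.

Definition is_base (B : Ensemble rule) : Prop :=
  forall A : atom, B (explosion A).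

Definition base_of_level_le (n : nat) (B : Ensemble rule) : Prop :=
  is_base B /\
  forall R : rule, B R -> (forall A : atom, R <> explosion A) -> level R <= n.

Definition extends (n : nat) (C B : Ensemble rule) : Prop :=
  Included rule B C /\ base_of_level_le n C.

(* [deriv B S A]: there is a derivation of A in B all of whose assumed rules are
   among S.  The case of an empty list of premises covers both the use of an
   axiom of B and the assumption of an atom. *)
Inductive deriv (B : Ensemble rule) : list rule -> atom -> Prop :=
| deriv_rule (S : list rule) (ps : list (list rule * atom)) (A : atom) :
    B (Rule ps A) \/ List.In (Rule ps A) S ->
    (forall (Rs : list rule) (Ai : atom),
        List.In (Rs, Ai) ps -> deriv B (Rs ++ S) Ai) ->
    deriv B S A.

Definition derivable (B : Ensemble rule) (A : atom) : Prop := deriv B [] A.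

(* In the clauses for disjunction and implication, consequence from a single
   formula is written out, since [entails] is defined from [valid]. *)
Fixpoint valid (n : nat) (B : Ensemble rule) (X : formula) : Prop :=
  match X with
  | Atom A => derivable B A
  | And Y Z => valid n B Y /\ valid n B Z
  | Or Y Z =>
      forall C : Ensemble rule, extends n C B ->
      forall D : atom,
        (forall E : Ensemble rule,
            extends n E C -> valid n E Y -> derivable E D) ->
        (forall E : Ensemble rule,
            extends n E C -> valid n E Z -> derivable E D) ->
        derivable C D
  | Imp Y Z =>
      forall C : Ensemble rule, extends n C B -> valid n C Y -> valid n C Z
  end.

Definition entails (n : nat) (B : Ensemble rule) (Gamma : list formula)
    (X : formula) : Prop :=
  match Gamma with
  | [] => valid n B X
  | _ => forall C : Ensemble rule, extends n C B ->
         (forall Y : formula, List.In Y Gamma -> valid n C Y) -> valid n C X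
  end.

(* [ext_deriv B S Gamma X]: there is an extended derivation of X whose open
   formulas are among Gamma and whose undischarged atomic rules are in B or
   among S. *)
Inductive ext_deriv (B : Ensemble rule) :
    list rule -> list formula -> formula -> Prop :=
| ext_assume S Gamma X :
    List.In X Gamma -> ext_deriv B S Gamma X
| ext_rule S Gamma ps A :
    B (Rule ps A) \/ List.In (Rule ps A) S ->
    (forall (Rs : list rule) (Ai : atom),
        List.In (Rs, Ai) ps -> ext_deriv B (Rs ++ S) Gamma (Atom Ai)) ->
    ext_deriv B S Gamma (Atom A)
| ext_andI S Gamma X Y :
    ext_deriv B S Gamma X -> ext_deriv B S Gamma Y ->
    ext_deriv B S Gamma (And X Y)
| ext_andE1 S Gamma X Y :
    ext_deriv B S Gamma (And X Y) -> ext_deriv B S Gamma X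
| ext_andE2 S Gamma X Y :
    ext_deriv B S Gamma (And X Y) -> ext_deriv B S Gamma Y
| ext_orI1 S Gamma X Y :
    ext_deriv B S Gamma X -> ext_deriv B S Gamma (Or X Y)
| ext_orI2 S Gamma X Y :
    ext_deriv B S Gamma Y -> ext_deriv B S Gamma (Or X Y)
| ext_orE S Gamma X Y Z :
    ext_deriv B S Gamma (Or X Y) ->
    ext_deriv B S (X :: Gamma) Z -> ext_deriv B S (Y :: Gamma) Z ->
    ext_deriv B S Gamma Z
| ext_impI S Gamma X Y :
    ext_deriv B S (X :: Gamma) Y -> ext_deriv B S Gamma (Imp X Y)
| ext_impE S Gamma X Y :
    ext_deriv B S Gamma (Imp X Y) -> ext_deriv B S Gamma X ->
    ext_deriv B S Gamma Y
| ext_botE S Gamma X :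
    ext_deriv B S Gamma (Atom Bot) -> ext_deriv B S Gamma X.

Definition IL_derivable (B : Ensemble rule) (Gamma : list formula)
    (X : formula) : Prop :=
  ext_deriv B [] Gamma X.

Definition IL_base_complete (n : nat) : Prop :=
  forall B : Ensemble rule, base_of_level_le n B ->
  forall (Gamma : list formula) (X : formula),
    entails n B Gamma X -> IL_derivable B Gamma X.

End Language.

(* Main.v *)
Require Import Defs.
From Stdlib Require Import Classical Ensembles List Arith.
From Stdlib Require Import FinFun.
Import ListNotations.

Set Implicit Arguments.

(** The clause for disjunction tests [B \/ C] only against atomic conclusions
    [D].  A base can use up almost all atoms: fix two distinct letters [p] and
    [q] and take as axioms all the other letters, so that the base has level
    [0].  In every extension of this base the only tests of [p \/ q] that
    matter are [D = p], [D = q] and [D = Bot]; the first two are the validity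
    of [(q -> p) -> p] and of [(p -> q) -> q], and the third follows from them
    by explosion.  Hence, whatever the bound [n] on the level of extensions,

      [(q -> p) -> p, (p -> q) -> q]  entails  [p \/ q]

    over this base (lemma [dummett_entails]).  The corresponding sequent, which
    is derivable in the logic of linear Kripke frames, is not derivable in
    intuitionistic logic over the base: it fails at the root of the Kripke model
    with two incomparable worlds above the root, one forcing [p] and the other
    [q], in which every remaining letter is forced everywhere
    ([dummett_not_derivable], by the soundness lemma [kripke_soundness]). *)

Section Kripke.

Variables (L W : Type) (le : W -> W -> Prop) (val : W -> L -> Prop).

Hypothesis le_refl : forall w, le w w.
Hypothesis le_trans : forall u v w, le u v -> le v w -> le u w.
Hypothesis val_mono : forall v w p, le v w -> val v p -> val w p.

Definition forces_atom (w : W) (A : atom L) : Prop :=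
  match A with
  | Letter p => val w p
  | Bot _ => False
  end.

(** Kripke forcing over the frame [(W, le)] with valuation [val]. *)
Fixpoint forces (w : W) (X : formula L) : Prop :=
  match X with
  | Atom A => forces_atom w A
  | And Y Z => forces w Y /\ forces w Z
  | Or Y Z => forces w Y \/ forces w Z
  | Imp Y Z => forall v, le w v -> forces v Y -> forces v Z
  end.

Lemma forces_mono X v w : le v w -> forces v X -> forces w X.
Proof.
  revert v w; induction X as [[p|]|Y IHY Z IHZ|Y IHY Z IHZ|Y IHY Z IHZ];
    simpl; intros v w Hvw.
  - now apply val_mono.
  - trivial.
  - intros [HY HZ]; eauto.
  - intros [HY|HZ]; eauto.
  - intros H u Hwu; apply H; eauto.
Qed.

(** A rule without discharge that preserves forcing at each world. *)
Definition sound_plain_rule (R : rule L) : Prop :=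
  let (ps, A) := R in
  (forall Rs Ai, In (Rs, Ai) ps -> Rs = []) /\
  forall w, (forall Rs Ai, In (Rs, Ai) ps -> forces_atom w Ai) ->
            forces_atom w A.

Lemma kripke_soundness (B : Ensemble (rule L)) Gamma X :
  (forall R, B R -> sound_plain_rule R) ->
  IL_derivable B Gamma X ->
  forall w, (forall Y, In Y Gamma -> forces w Y) -> forces w X.
Proof.
  unfold IL_derivable; intros HB HX.
  (* The rules of [B] discharge nothing, so the list of assumed rules stays
     empty throughout the derivation. *)
  remember [] as S eqn:HS.
  induction HX as
    [ S Gamma X Hin
    | S Gamma ps A Hrule _ IH
    | S Gamma X Y _ IH1 _ IH2
    | S Gamma X Y _ IH
    | S Gamma X Y _ IH
    | S Gamma X Y _ IH
    | S Gamma X Y _ IH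
    | S Gamma X Y Z _ IH0 _ IH1 _ IH2
    | S Gamma X Y _ IH
    | S Gamma X Y _ IH1 _ IH2
    | S Gamma X _ IH ]; subst S; intros w Hw.
  - now apply Hw.
  - destruct Hrule as [Hrule|[]].
    destruct (HB _ Hrule) as [Hplain Hsound].
    apply Hsound; intros Rs Ai Hin.
    apply (IH Rs Ai Hin); [|exact Hw].
    now rewrite (Hplain _ _ Hin).
  - split; [apply IH1|apply IH2]; auto.
  - now apply (IH eq_refl w Hw).
  - now apply (IH eq_refl w Hw).
  - left; auto.
  - right; auto.
  - destruct (IH0 eq_refl w Hw) as [HX|HY].
    + apply IH1; [reflexivity|]. intros V [<-|HV]; auto.
    + apply IH2; [reflexivity|]. intros V [<-|HV]; auto.
  - intros v Hwv HX.
    apply IH; [reflexivity|].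
    intros V [<-|HV]; [exact HX|]. apply (forces_mono V Hwv); auto.
  - exact (IH1 eq_refl w Hw w (le_refl w) (IH2 eq_refl w Hw)).
  - destruct (IH eq_refl w Hw).
Qed.

End Kripke.

Lemma derivable_explosion L (B : Ensemble (rule L)) A :
  is_base B -> derivable B (Bot L) -> derivable B A.
Proof.
  intros HB HBot.
  apply deriv_rule with (ps := [([], Bot L)]); [left; apply HB|].
  intros Rs Ai [[= <- <-]|[]]; exact HBot.
Qed.

Lemma derivable_axiom L (B : Ensemble (rule L)) A :
  B (Rule [] A) -> derivable B A.
Proof.
  intros HA; apply deriv_rule with (ps := []); [now left|intros Rs Ai []].
Qed.

Section Counterexample.

Variables (L : Type) (p q : L).
Hypothesis p_neq_q : p <> q.

(** The base whose axioms are all the letters other than [p] and [q]. *)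
Definition two_letter_base : Ensemble (rule L) := fun R =>
  (exists A, R = explosion A) \/
  (exists r, r <> p /\ r <> q /\ R = Rule [] (Letter r)).

Lemma two_letter_base_level n : base_of_level_le n two_letter_base.
Proof.
  split.
  - intros A; left; now exists A.
  - intros R [[A ->]|[r [_ [_ ->]]]] HR.
    + now destruct (HR A).
    + apply Nat.le_0_l.
Qed.

Let fp : formula L := Atom (Letter p).
Let fq : formula L := Atom (Letter q).

(** The conjuncts of Dummett's definition of [p \/ q] by implication and
    conjunction in the logic of linear frames. *)
Definition dummett : list (formula L) :=
  [Imp (Imp fq fp) fp; Imp (Imp fp fq) fq].

Lemma dummett_entails n : entails n two_letter_base dummett (Or fp fq).
Proof.
  intros B [HB _] Hdummett C [HBC HC] D Hp Hq; simpl in Hp, Hq.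
  assert (Hqp : valid n B (Imp (Imp fq fp) fp)) by (apply Hdummett; simpl; auto).
  assert (Hpq : valid n B (Imp (Imp fp fq) fq)) by (apply Hdummett; simpl; auto).
  simpl in Hqp, Hpq.
  assert (HCB : extends n C B) by (split; assumption).
  assert (HCC : extends n C C) by (split; [now intros R|assumption]).
  destruct D as [r|].
  - destruct (classic (r = p)) as [->|Hrp]; [now apply Hqp|].
    destruct (classic (r = q)) as [->|Hrq]; [now apply Hpq|].
    apply derivable_axiom, HBC, HB; right; exists r; auto.
  - (* As [q] yields [Bot], it yields [p]; so [p] holds, and it yields [Bot]. *)
    apply (Hp C HCC), (Hqp C HCB).
    intros E HE HEq.
    apply derivable_explosion; [apply HE|now apply Hq].
Qed.

(** The worlds [Left] and [Right] are incomparable and lie above [Root]. *)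
Inductive fork : Type := Root | Left | Right.

Definition fork_le (v w : fork) : Prop := v = Root \/ v = w.

(** [p] is forced at [Left] only, [q] at [Right] only, and every other letter
    at all worlds. *)
Definition fork_val (w : fork) (r : L) : Prop :=
  (r = p -> w = Left) /\ (r = q -> w = Right).

Lemma fork_le_refl w : fork_le w w.
Proof. now right. Qed.

Lemma fork_le_trans u v w : fork_le u v -> fork_le v w -> fork_le u w.
Proof. intros [-> | ->] H; [now left|exact H]. Qed.

Lemma fork_val_mono v w r : fork_le v w -> fork_val v r -> fork_val w r.
Proof.
  intros [->|<-] [Hp Hq]; [|now split].
  split; intros Hr; [discriminate (Hp Hr)|discriminate (Hq Hr)].
Qed.

Lemma fork_val_p w : fork_val w p <-> w = Left.
Proof.
  split; [now intros [Hp _]; apply Hp|].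
  intros ->; split; [easy|]. intros H; now destruct p_neq_q.
Qed.

Lemma fork_val_q w : fork_val w q <-> w = Right.
Proof.
  split; [now intros [_ Hq]; apply Hq|].
  intros ->; split; [|easy]. intros H; now destruct p_neq_q.
Qed.

Lemma two_letter_base_sound R :
  two_letter_base R -> sound_plain_rule fork_val R.
Proof.
  intros [[A ->]|[r [Hrp [Hrq ->]]]]; split.
  - intros Rs Ai [[= <- <-]|[]]; reflexivity.
  - intros w H; destruct (H [] (Bot L)); now left.
  - intros Rs Ai [].
  - intros w _; split; intros ->; contradiction.
Qed.

Lemma fork_forces_dummett Y :
  In Y dummett -> forces fork_le fork_val Root Y.
Proof.
  (* A world [v] at which [q -> p] is forced does not lie below [Right], so
     [v] is [Left]; symmetrically for [p -> q]. *)
  intros [<-|[<-|[]]]; intros v _ Hv; simpl in *;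
    [apply fork_val_p|apply fork_val_q];
    destruct v; try reflexivity; exfalso.
  - assert (H : fork_val Right p)
      by (apply Hv; [now left|now apply fork_val_q]).
    now apply fork_val_p in H.
  - assert (H : fork_val Right p)
      by (apply Hv; [now right|now apply fork_val_q]).
    now apply fork_val_p in H.
  - assert (H : fork_val Left q)
      by (apply Hv; [now left|now apply fork_val_p]).
    now apply fork_val_q in H.
  - assert (H : fork_val Left q)
      by (apply Hv; [now right|now apply fork_val_p]).
    now apply fork_val_q in H.
Qed.

Lemma dummett_not_derivable :
  ~ IL_derivable two_letter_base dummett (Or fp fq).
Proof.
  intros H.
  destruct (kripke_soundness fork_le fork_val
              fork_le_refl fork_le_trans fork_val_mono
              two_letter_base_sound H Root fork_forces_dummett) as [Hp|Hq].
  - now apply fork_val_p in Hp.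
  - now apply fork_val_q in Hq.
Qed.

End Counterexample.

Lemma not_Finite_two_elements (T : Type) :
  ~ Finite T -> exists x y : T, x <> y.
Proof.
  intros Hinf; apply NNPP; intros Hno.
  apply Hinf.
  destruct (classic (exists x : T, True)) as [[x _]|Hempty].
  - exists [x]; intros y; left.
    apply NNPP; intros Hxy; apply Hno; now exists x, y.
  - exists []; intros y; destruct Hempty; now exists y.
Qed.

Theorem corollary13 (L : Type) (L_infinite : ~ Finite L) (n : nat) :
  ~ IL_base_complete L n.
Proof.
  intros Hcomplete.
  destruct (not_Finite_two_elements L_infinite) as [p [q Hpq]].
  apply (dummett_not_derivable Hpq).
  apply Hcomplete; [apply two_letter_base_level|apply dummett_entails].
Qed.
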